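(* Let $\Gamma\subset\mathbb R^2$ be a compact rectifiable curve having a positive curved trace. If $E\subset\mathbb R^2$ is compact and $\dim_{\mathrm H}(E)>1$, then \[ |E+\Gamma|>0 . \]
   Context: A compact rectifiable curve is the image of a continuous rectifiable path on a compact interval. A compact rectifiable curve $\Gamma\subset\mathbb R^2$ has a positive curved trace if there are a compact $C^2$ graph $\Sigma=\{(x,g(x)):x\in I\}$ ($I$ a compact interval, $g\in C^2(I)$), a compact set $A\subset\Gamma\cap\Sigma$, and a constant $c_0>0$ such that $\mathcal H^1(A)>0$ and $|g''(x)|\ge c_0$ for every $x\in I$. Here $\mathcal H^1$ is one-dimensional Hausdorff measure, $E+\Gamma=\{x+y:x\in E,\ y\in\Gamma\}$, $|\cdot|$ is planar Lebesgue measure, and $\dim_{\mathrm H}$ is Hausdorff dimension. *)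

(* Defs.v *)
From HB Require Import structures.
From mathcomp Require Import all_boot all_order all_algebra.
From mathcomp Require Import all_classical all_reals all_analysis.

Set Implicit Arguments.
Unset Strict Implicit.
Unset Printing Implicit Defensive.

Import Order.TTheory GRing.Theory Num.Theory.
Import numFieldNormedType.Exports.

Local Open Scope classical_set_scope.
Local Open Scope ring_scope.

(* The plane is R * R. Its library norm is the max norm, which induces the
   right topology but not the right lengths and diameters; the Euclidean
   distance is therefore introduced separately. *)
Definition edist (R : realType) (x y : R * R) : R :=
  Num.sqrt ((x.1 - y.1) ^+ 2 + (x.2 - y.2) ^+ 2).

Definition minkowski_sum (R : realType) (A B : set (R * R)) : set (R * R) :=
  [set x + y | x in A & y in B].

Definition planar_lebesgue (R : realType) : set (R * R) -> \bar R :=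
  (@lebesgue_measure R \x @lebesgue_measure R)%E.

(* 0 is added so that the empty set has diameter 0 rather than -oo. *)
Definition diam (R : realType) (A : set (R * R)) : \bar R :=
  ereal_sup (0%E |` [set (edist x y)%:E | x in A & y in A]).

(* diam(A)^s with the conventions needed when s = 0: the empty set
   contributes 0, a point contributes 0^0 = 1. *)
Definition diam_pow (R : realType) (s : R) (A : set (R * R)) : \bar R :=
  if A == set0 then 0%E else poweR (diam A) s.

Definition delta_cover (R : realType) (delta : R) (A : set (R * R))
    (U : (set (R * R))^nat) : Prop :=
  A `<=` \bigcup_i U i /\ forall i, (diam (U i) <= delta%:E)%E.

Definition hausdorff_premeasure (R : realType) (s delta : R)
    (A : set (R * R)) : \bar R :=
  ereal_inf [set (\sum_(0 <= i <oo) diam_pow s (U i))%E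
            | U in delta_cover delta A].

(* No normalizing constant: for s = 1 the usual one is 1. *)
Definition hausdorff_measure (R : realType) (s : R) (A : set (R * R)) :
    \bar R :=
  ereal_sup [set hausdorff_premeasure s delta A
            | delta in [set delta : R | 0 < delta]].

Definition hausdorff_dim (R : realType) (A : set (R * R)) : \bar R :=
  ereal_inf [set s%:E
            | s in [set s : R | 0 <= s /\ hausdorff_measure s A = 0%E]].

(* l ranges over the seqs such that a :: l is a subdivision of [a, b], as in
   the library's variation. *)
Definition path_length (R : realType) (a b : R) (gamma : R -> R * R) :
    \bar R :=
  ereal_sup [set (\sum_(0 <= n < size l)
                   edist (gamma (nth b (a :: l) n))
                         (gamma (nth b (a :: l) n.+1)))%:E
            | l in itv_partition a b].

Definition compact_rectifiable_curve (R : realType) (Gamma : set (R * R)) :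
    Prop :=
  exists a b : R, exists gamma : R -> R * R,
    [/\ a <= b,
        {within `[a, b], continuous gamma},
        (path_length a b gamma < +oo)%E &
        Gamma = gamma @` `[a, b]].

(* g' is the derivative of g relative to I (one-sided at endpoints): x^' is
   the punctured neighborhood filter of x. The values of g outside I are
   irrelevant. *)
Definition deriv_on (R : realType) (I : set R) (g g' : R -> R) : Prop :=
  forall x, I x -> (g y - g x) / (y - x) @[y --> within I x^'] --> g' x.

Definition C2_on (R : realType) (I : set R) (g g' g'' : R -> R) : Prop :=
  [/\ deriv_on I g g', deriv_on I g' g'' & {within I, continuous g''}].

(* c < d makes g' and g'' unique on [c, d]; a one-point interval is useless
   anyway, since its graph contains no set of positive length. *)
Definition positive_curved_trace (R : realType) (Gamma : set (R * R)) :
    Prop :=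
  exists c d : R, exists g g' g'' : R -> R,
  exists A : set (R * R), exists c0 : R,
    [/\ c < d /\ C2_on `[c, d] g g' g'',
        compact A /\ A `<=` Gamma `&` [set (x, g x) | x in `[c, d]],
        (0 < hausdorff_measure 1 A)%E,
        0 < c0 &
        forall x, x \in `[c, d] -> c0 <= `|g'' x|].

(* Main.v *)
Require Import Defs.
From mathcomp Require Import all_boot all_order all_algebra.
From mathcomp Require Import all_classical all_reals all_analysis.
From mathcomp Require Import measurable_realfun.
From mathcomp Require Import lra ring zify.
Import Order.TTheory GRing.Theory Num.Theory.
Import numFieldNormedType.Exports.
Local Open Scope classical_set_scope.
Local Open Scope ring_scope.

Set Implicit Arguments.
Unset Strict Implicit.
Unset Printing Implicit Defensive.

(** Let [A] be the piece of [Gamma] lying on the graph of [g], and [T] its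
projection to the first axis. It is enough to bound from below, uniformly in a
small scale [delta], the measure of the [delta]-neighbourhood of
[E + Gamma]: since [E + Gamma] is compact, these measures converge to its own
measure ([compact_measure_ge]).

The bound is a second-moment argument. Since [E] has dimension greater than 1,
for some [s > 1] it carries, at every scale [delta], a finite weighted set of
points of total weight bounded below such that each square of side
[r >= delta] has weight at most [r^s] ([frostman], [grid_content_ge],
[frostman_grid]). To a point [p] of this set attach the thin strip
[p + A + {0} x [0, delta]] and let [F] be the weighted sum of the indicators of
these strips; it is supported in the [delta]-neighbourhood of [E + Gamma]. A
strip has measure at least [tau * delta] for a constant [tau > 0], because [A]
has positive length ([lipschitz_graph_translates], [strip_measure_ge]). So the
integral of [F] is at least a constant times [W * delta], with [W] the total
weight.

The integral of [F^2] is the weighted sum of the measures of the overlaps of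
two strips, and this is where curvature enters. Suppose that the strips at [p]
and [q] meet above the abscissa [p.1 + t], and put [h = q.1 - p.1]. Then
[g t - g (t - h)] is within [delta] of [q.2 - p.2]. As a function of [t] it has
slope at least [c0 * |h|], because [|g''| >= c0]; so [t] is confined to an
interval of length [O(delta / |h|)], and the overlap has measure
[O(delta^2 / |h|)]. As [g] is Lipschitz, strips that meet satisfy
[|q - p| = O(|h| + delta)], and the overlap is
[O(delta^2 / max(|p - q|, delta))] ([strip_overlap_le]). Summed over all pairs,
this is [delta^2] times a discrete 1-energy of the weights. Annulus by annulus,
the sum over [q] for fixed [p] is at most a constant times the sum over
[k] of [r_k^(s - 1)], [r_k] being the dyadic sides: a convergent geometric
series ([weights_sum_kernel], [side_powR_geometric]). Hence the integral of
[F^2] is [O(W * delta^2)], and the Cauchy-Schwarz inequality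
([weighted_cauchy_schwarz]) bounds the measure of the support of [F] from below
by a constant times [W], whatever [delta] is ([union_measure_ge]). *)

(** * Frostman weights on a tree of cells *)

(** A finitely supported measure is a list of weighted points, which spares any
equality test or choice on the points. *)
Definition mass (R : realType) (X : Type) (w : seq (X * {nonneg R}))
    (P : pred X) : R :=
  \sum_(z <- w | P z.1) z.2%:num.

Lemma mass_cat (R : realType) (X : Type) (w1 w2 : seq (X * {nonneg R}))
    (P : pred X) :
  mass (w1 ++ w2) P = mass w1 P + mass w2 P.
Proof. by rewrite /mass big_cat. Qed.

Lemma mass_scale (R : realType) (X : Type) (t : {nonneg R})
    (w : seq (X * {nonneg R})) (P : pred X) :
  mass [seq (z.1, (t%:num * z.2%:num)%:nng) | z <- w] P = t%:num * mass w P.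
Proof. by rewrite /mass big_map /= mulr_sumr. Qed.

Definition weights_on (R : realType) (X : Type) (D : set X)
    (w : seq (X * {nonneg R})) : Prop :=
  List.Forall (fun z : X * {nonneg R} => D z.1) w.

Lemma mass_ge0 (R : realType) (X : Type) (w : seq (X * {nonneg R}))
    (P : pred X) : 0 <= mass w P.
Proof. by apply: sumr_ge0 => z _. Qed.

Lemma mass_le (R : realType) (X : Type) (D : set X) (w : seq (X * {nonneg R}))
    (P Q : pred X) : weights_on D w ->
  (forall x, D x -> P x -> Q x) -> mass w P <= mass w Q.
Proof.
move=> + PQ; elim=> [|z w' Dz _ ih]; first by rewrite /mass !big_nil.
rewrite /mass !big_cons; case: (boolP (P z.1)) => [/(PQ _ Dz) -> |_].
  by rewrite lerD2l.
by case: ifP => // _; rewrite (le_trans ih)// lerDr.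
Qed.

Lemma mass_eq0 (R : realType) (X : Type) (D : set X) (w : seq (X * {nonneg R}))
    (P : pred X) : weights_on D w ->
  (forall x, D x -> ~~ P x) -> mass w P = 0.
Proof.
move=> + DP; elim=> [|z w' Dz _ ih]; first by rewrite /mass !big_nil.
by rewrite /mass big_cons (negbTE (DP _ Dz)).
Qed.

Lemma weights_onS (R : realType) (X : Type) (D D' : set X)
    (w : seq (X * {nonneg R})) : D `<=` D' -> weights_on D w ->
  weights_on D' w.
Proof. by move=> DD'; apply: List.Forall_impl => z /DD'. Qed.

Lemma mass_mem_le (R : realType) (X : Type) (I : eqType) (D : set X)
    (w : seq (X * {nonneg R})) (c : X -> I) (cs : seq I) (b : R) :
  weights_on D w -> (forall q, mass w (fun x => c x == q) <= b) ->
  mass w (fun x => c x \in cs) <= (size cs)%:R * b.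
Proof.
move=> wD wb; elim: cs => [|q cs ih].
  by rewrite mul0r (@mass_eq0 _ _ D).
rewrite /= -natr1 mulrDl mul1r (le_trans _ (lerD ih (wb q)))//.
rewrite /mass; elim: wD => [|z w' Dz _ ih']; first by rewrite !big_nil addr0.
have z0 : 0 <= z.2%:num by [].
by rewrite !big_cons inE; case: (c z.1 == q); case: (c z.1 \in cs) => //=; lra.
Qed.

Section frostman.
Variables (R : realType) (X : Type) (I : eqType).
Variables (cell : nat -> X -> I) (E : set X) (r : nat -> R).
Hypothesis r_ge0 : forall k, 0 <= r k.
Hypothesis cell_refine : forall k x y,
  cell k.+1 x = cell k.+1 y -> cell k x = cell k y.
Hypothesis cell_finite : forall k q, exists cs : seq I,
  forall x, E x -> cell k x = q -> cell k.+1 x \in cs.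

Lemma cell_coarser k k' x y : (k <= k')%N ->
  cell k' x = cell k' y -> cell k x = cell k y.
Proof.
move=> /subnKC <-; elim: (k' - k)%N => [|m ih]; first by rewrite addn0.
by rewrite addnS => /cell_refine.
Qed.

Definition frostman_weights (D : set X) (k m : nat)
    (w : seq (X * {nonneg R})) : Prop :=
  weights_on D w /\
  forall k' q, (k <= k' <= m)%N -> mass w (fun x => cell k' x == q) <= r k'.

Definition cell_cover (D : set X) (k m : nat) (cov : seq (nat * I)) : Prop :=
  forall x, D x -> exists2 c, c \in cov & (k <= c.1 <= m)%N /\ cell c.1 x = c.2.

(** Weights and covers of disjoint cells of level [k] can be concatenated:
a cell of level at least [k] meets at most one of them, so the mass bounds are
not added up. The set [D], a union of cells of level [k], keeps the resulting
points inside the parent cell. *)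
Lemma frostman_siblings (k m : nat) (cs : seq I) (D : set X) :
  (forall q, exists w cov,
    [/\ frostman_weights (E `&` [set x | cell k x = q]) k m w,
     cell_cover (E `&` [set x | cell k x = q]) k m cov &
     \sum_(c <- cov) r c.1 <= mass w xpredT]) ->
  (forall x y, D x -> cell k x = cell k y -> D y) ->
  exists w cov,
    [/\ frostman_weights (E `&` D `&` [set x | cell k x \in cs]) k m w,
     cell_cover (E `&` D `&` [set x | cell k x \in cs]) k m cov &
     \sum_(c <- cov) r c.1 <= mass w xpredT].
Proof.
move=> ih satD; elim: cs => [|q cs [w2 [cov2 [[w2D w2r] cov2D cov2w]]]].
  exists [::], [::]; split.
  - by split=> [|k' q _]; [constructor | rewrite /mass big_nil].
  - by move=> x [].
  - by rewrite /mass !big_nil.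
have [qD|qD] := pselect (
  (exists2 x, D x & cell k x = q) /\ q \notin cs); last first.
  exists w2, cov2; split=> //.
  - split=> //; apply: weights_onS w2D => x [[Ex Dx] /= xcs]; split=> //=.
    by rewrite inE xcs orbT.
  - move=> x [[Ex Dx]] /=; rewrite inE => /orP[/eqP xq|xcs]; last exact: cov2D.
    apply: cov2D; split=> //=; rewrite xq; apply: contrapT => /negP qcs.
    by apply: qD; split=> //; exists x.
case: qD => -[x0 Dx0 x0q] qcs.
have [w1 [cov1 [[w1D w1r] cov1D cov1w]]] := ih q.
exists (w1 ++ w2), (cov1 ++ cov2); split.
- split.
    apply/List.Forall_app; split.
      apply: weights_onS w1D => x [Ex /= xq]; split; last by rewrite /= inE xq eqxx.
      by split=> //; apply: (satD x0) => //; rewrite x0q.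
    apply: weights_onS w2D => x [[Ex Dx] /= xcs]; split=> //=.
    by rewrite inE xcs orbT.
  move=> k' q' kk'; rewrite mass_cat.
  have [[x [Ex xq] /eqP xq']|nx] := pselect (exists2 x,
      (E `&` [set x | cell k x = q]) x & cell k' x == q').
    rewrite [X in _ + X](mass_eq0 w2D) ?addr0; first exact: w1r.
    move=> y [_ /= ycs]; apply: contra qcs => /eqP yq'.
    rewrite -xq (_ : cell k x = cell k y)//.
    by apply: (@cell_coarser _ k'); [case/andP: kk' | rewrite xq' yq'].
  rewrite (mass_eq0 w1D) ?add0r; first exact: w2r.
  by move=> x xD; apply/negP => xq'; apply: nx; exists x.
- move=> x [[Ex Dx]] /=; rewrite inE => /orP[/eqP xq|xcs].
    by have [c cc ?] := cov1D x (conj Ex xq); exists c; rewrite // mem_cat cc.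
  have [c cc ?] := cov2D x (conj (conj Ex Dx) xcs).
  by exists c; rewrite // mem_cat cc orbT.
- by rewrite big_cat mass_cat; exact: lerD.
Qed.

(** Finite form of Frostman's lemma, the duality between a largest measure with
prescribed capacities [r] and a cheapest cover. Both are built together, from
the leaves up. The children's weights are put together; if they respect
the capacity of the parent they are kept, with the union of the covers.
Otherwise they are scaled down until they fill that capacity exactly, and then
the parent alone is a cover of cost equal to the total weight. *)
Lemma frostman (m k : nat) (q : I) : exists w cov,
  [/\ frostman_weights (E `&` [set x | cell k x = q]) k (k + m) w,
     cell_cover (E `&` [set x | cell k x = q]) k (k + m) cov &
     \sum_(c <- cov) r c.1 <= mass w xpredT].
Proof.
elim: m k q => [|m ih] k q; set D := E `&` _.
  rewrite addn0.
  have [[x Dx]|nD] := pselect (D !=set0).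
    exists [:: (x, NngNum (r_ge0 k))], [:: (k, q)]; split.
    - split; first by constructor; [exact: Dx | constructor].
      move=> k' q'; rewrite -eqn_leq => /eqP <-.
      by rewrite /mass big_cons big_nil; case: ifP; rewrite ?addr0.
    - by move=> y [_ yq]; exists (k, q); rewrite ?inE //= leqnn.
    - by rewrite /mass !big_cons !big_nil.
  exists [::], [::]; split.
  - by split=> [|k' q' _]; [constructor | rewrite /mass big_nil].
  - by move=> x Dx; exfalso; apply: nD; exists x.
  - by rewrite /mass !big_nil.
have [cs csP] := cell_finite k q.
have [||w [cov [[wD wr] covD covw]]] :=
    @frostman_siblings k.+1 (k + m.+1) cs [set x | cell k x = q].
- by rewrite -addSnnS => q'; exact: ih.
- by move=> x y /= <- /cell_refine.
have wD' : weights_on D w.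
  by apply: weights_onS wD => x [[]].
have [wk|wk] := leP (mass w xpredT) (r k).
  exists w, cov; split=> //.
  - split=> // k' q' /andP[+ k'm]; rewrite leq_eqVlt => /orP[/eqP <-|kk'].
      by apply: le_trans wk; exact: mass_le wD _.
    by apply: wr; rewrite kk'.
  - move=> x [Ex xq]; have [|c cc [/andP[kc ?] ?]] := covD x.
      by split=> //; exact: csP.
    by exists c => //; split=> //; apply/andP; split => //; exact: ltnW.
have W0 : 0 < mass w xpredT by exact: le_lt_trans wk.
set t := r k / mass w xpredT.
have t0 : 0 <= t by rewrite divr_ge0// ltW.
have t1 : t <= 1 by rewrite ler_pdivrMr// mul1r ltW.
exists [seq (z.1, ((NngNum t0)%:num * z.2%:num)%:nng) | z <- w], [:: (k, q)]; split.
- split.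
    by apply/List.Forall_map; apply: List.Forall_impl wD'.
  move=> k' q' /andP[+ k'm]; rewrite mass_scale /=.
  rewrite leq_eqVlt => /orP[/eqP <-|kk'].
    rewrite (@le_trans _ _ (t * mass w xpredT))//.
      by rewrite ler_wpM2l//; exact: mass_le wD _.
    by rewrite /t divfK// gt_eqF.
  rewrite (@le_trans _ _ (mass w (fun x => cell k' x == q')))//.
    by rewrite ler_piMl// mass_ge0.
  by apply: wr; rewrite kk'.
- by move=> x [Ex xq]; exists (k, q); rewrite ?inE//= leqnn leq_addr.
- by rewrite big_cons big_nil addr0 mass_scale /= /t divfK// gt_eqF.
Qed.

End frostman.

(** * Second moments, and measures of compact planar sets *)

Lemma measurable_scaled_indic d (T : measurableType d) (R : realType)
    (A : set T) (c : R) : measurable A ->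
  measurable_fun [set: T] ((fun x => (c * \1_A x)%:E) : T -> \bar R).
Proof.
by move=> mA; apply/measurable_EFinP; apply: measurable_funM => //.
Qed.

Lemma integral_scaled_indic d (T : measurableType d) (R : realType)
    (mu : {measure set T -> \bar R}) (A : set T) (c : R) :
  0 <= c -> measurable A ->
  (\int[mu]_x (c * \1_A x)%:E = c%:E * mu A)%E.
Proof.
move=> c0 mA; under eq_integral do rewrite EFinM.
rewrite ge0_integralZl_EFin//; first by rewrite integral_indic// setIT.
by apply/measurable_EFinP; exact: measurable_indic.
Qed.

(** Integral of the pointwise inequality [2 * lam * F <= F^2 + lam^2 * 1_U] for
[F] the weighted sum of the indicators of the [S x], which is supported in [U].
Optimising [lam] gives the Cauchy-Schwarz inequality
[(\int F)^2 <= (\int F^2) * mu U]; leaving [lam] free keeps every integrand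
nonnegative, so that no integrability has to be checked. *)
Lemma weighted_cauchy_schwarz d (T : measurableType d) (R : realType)
    (mu : {measure set T -> \bar R}) (X : Type) (w : seq (X * {nonneg R}))
    (D : set X) (S : X -> set T) (U : set T) (lam : {nonneg R}) :
  weights_on D w -> (forall x, measurable (S x)) ->
  (forall x, D x -> S x `<=` U) -> measurable U ->
  (\sum_(z <- w) (2 * lam%:num * z.2%:num)%:E * mu (S z.1) <=
   \sum_(z <- w) \sum_(z' <- w)
     (z.2%:num * z'.2%:num)%:E * mu (S z.1 `&` S z'.1) +
   (lam%:num ^+ 2)%:E * mu U)%E.
Proof.
move=> wD mS SU mU.
pose ind (A : set T) x : R := \1_A x.
have mind (A : set T) (c : R) : measurable A ->
    measurable_fun [set: T] ((fun x => (c * ind A x)%:E) : T -> \bar R).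
  exact: measurable_scaled_indic.
have intE (A : set T) (c : R) : 0 <= c -> measurable A ->
    (\int[mu]_x (c * ind A x)%:E = c%:E * mu A)%E.
  exact: integral_scaled_indic.
have ind0 A x : 0 <= ind A x by rewrite /ind indicE ler0n.
have mSS x y : measurable (S x `&` S y) by exact: measurableI.
pose F x := \sum_(z <- w) (z.2%:num * ind (S z.1) x).
(* Off [U] both sides vanish; on [U] this is [0 <= (F x - lam)^2]. *)
have pw x : 2 * lam%:num * F x <= F x ^+ 2 + lam%:num ^+ 2 * ind U x.
  have [xU|xU] := pselect (U x).
    rewrite /ind indicE mem_set// mulr1; move: (F x) => a.
    rewrite -subr_ge0 (_ : _ - _ = (a - lam%:num) ^+ 2) ?sqr_ge0//; ring.
  suff -> : F x = 0 by rewrite mulr0 addr_ge0// mulr_ge0// sqr_ge0.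
  rewrite /F; elim: wD => [|z w' Dz _ ih]; first by rewrite big_nil.
  rewrite big_cons ih addr0 /ind indicE memNset ?mulr0// => Sx.
  by apply: xU; exact: SU Sx.
pose f1 (z : X * {nonneg R}) x := (2 * lam%:num * z.2%:num * ind (S z.1) x)%:E.
pose f2 (z z' : X * {nonneg R}) x :=
  (z.2%:num * z'.2%:num * ind (S z.1 `&` S z'.1) x)%:E.
rewrite [leLHS](_ : _ = \int[mu]_x (\sum_(z <- w) f1 z x))%E; last first.
  rewrite ge0_integral_sum//.
  - by apply: eq_bigr => z _; rewrite intE.
  - by move=> z; exact: mind.
  - by move=> z x _; rewrite lee_fin mulr_ge0.
rewrite [X in (_ <= X + _)%E](_ : _ =
    \int[mu]_x (\sum_(z <- w) \sum_(z' <- w) f2 z z' x))%E; last first.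
  rewrite ge0_integral_sum//.
  - apply: eq_bigr => z _; rewrite ge0_integral_sum//.
    + by apply: eq_bigr => z' _; rewrite intE.
    + by move=> z'; exact: mind.
    + by move=> z' x _; rewrite lee_fin mulr_ge0.
  - by move=> z; apply: emeasurable_sum => z'; exact: mind.
  - by move=> z x _; apply: sume_ge0 => z' _; rewrite lee_fin mulr_ge0.
have f20 x : (0 <= \sum_(z <- w) \sum_(z' <- w) f2 z z' x)%E.
  by apply: sume_ge0 => z _; apply: sume_ge0 => z' _; rewrite lee_fin mulr_ge0.
have mf2 : measurable_fun [set: T]
    ((fun x => \sum_(z <- w) \sum_(z' <- w) f2 z z' x)%E : T -> \bar R).
  by apply: emeasurable_sum => z; apply: emeasurable_sum => z'; exact: mind.
rewrite -intE ?sqr_ge0// -ge0_integralD//; last 2 first.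
  by move=> x _; rewrite lee_fin mulr_ge0// sqr_ge0.
  exact: mind.
apply: ge0_le_integral => //.
- by move=> x _; apply: sume_ge0 => z _; rewrite lee_fin mulr_ge0.
- by apply: emeasurable_sum => z; exact: mind.
- by apply: emeasurable_funD => //; exact: mind.
move=> x _.
rewrite [leLHS](_ : _ = (2 * lam%:num * F x)%:E); last first.
  by rewrite sumEFin /F mulr_sumr; congr EFin; apply: eq_bigr => z _; rewrite mulrA.
rewrite [X in (_ <= X + _)%E](_ : _ = (F x ^+ 2)%:E) ?lee_fin//.
rewrite expr2 {1}/F mulr_suml -sumEFin; apply: eq_bigr => z _.
rewrite sumEFin /F mulr_sumr; congr EFin; apply: eq_bigr => z' _.
by rewrite /ind indicI/= mulrACA.
Qed.

Section plane_topology.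
Variable R : realType.
Notation plane := (measurableTypeR R * measurableTypeR R)%type.
Notation mu := (@lebesgue_measure R \x @lebesgue_measure R)%E.

(** The sigma-algebra of the plane is that of measurable rectangles; an open set
is the union of the rational boxes that it contains, which are countably
many. *)
Lemma open_measurable_plane (U : set (R * R)) :
  open U -> measurable (U : set plane).
Proof.
move=> oU.
(* Centre with rational coordinates and half-side [1 / (n + 1)]. *)
pose box (q : rat * rat * nat) : set (R * R) :=
  ball (ratr q.1.1 : R) q.2.+1%:R^-1 `*` ball (ratr q.1.2 : R) q.2.+1%:R^-1.
have -> : U = \bigcup_q (if `[< box q `<=` U >] then box q else set0).
  apply/seteqP; split=> [x Ux|x [q _]]; last by case: asboolP => // qU /qU.
  have /nbhs_ballP[e /= e0 eU] : nbhs x U by exact: open_nbhs_nbhs.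
  have [n ne] : exists n, n.+1%:R^-1 < e / 2.
    have e20 : 0 < e / 2 by rewrite divr_gt0.
    have [n _ /(_ _ (leqnn n)) nP] := near_infty_natSinv_lt (PosNum e20).
    by exists n.
  have n0 : 0 < n.+1%:R^-1 :> R by rewrite invr_gt0.
  have rat_near (y r : R) : 0 < r -> exists q : rat, `|ratr q - y| < r.
    move=> r0; have [q] := @rat_in_itvoo R (y - r) (y + r) ltac:(lra).
    by rewrite in_itv/= => /andP[? ?]; exists q; rewrite ltr_distl; apply/andP.
  have [q1 q1x] := rat_near x.1 _ n0.
  have [q2 q2x] := rat_near x.2 _ n0.
  exists (q1, q2, n) => //.
  have qU : box (q1, q2, n) `<=` U.
    move=> y [/= y1 y2]; apply: eU; move: ne q1x q2x y1 y2.
    move: (n.+1%:R^-1) => r ne q1x q2x; rewrite /ball/= => y1 y2; split; rewrite /ball/=.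
      rewrite (_ : _ - _ = (x.1 - ratr q1) + (ratr q1 - y.1)); last by ring.
      by rewrite (le_lt_trans (ler_normD _ _))// distrC; lra.
    rewrite (_ : _ - _ = (x.2 - ratr q2) + (ratr q2 - y.2)); last by ring.
    by rewrite (le_lt_trans (ler_normD _ _))// distrC; lra.
  by case: asboolP.
apply: countable_bigcupT_measurable => [|q]; first exact: countableP.
case: ifP => // _; apply: measurableX; exact: measurable_ball.
Qed.

Lemma closed_measurable_plane (K : set (R * R)) :
  closed K -> measurable (K : set plane).
Proof.
by move=> cK; rewrite -[K]setCK; apply: measurableC;
  apply: open_measurable_plane; exact: closed_openC.
Qed.

Lemma compact_measurable_plane (K : set (R * R)) :
  compact K -> measurable (K : set plane).
Proof.
move=> cK; apply: closed_measurable_plane; apply: compact_closed cK.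
exact: norm_hausdorff.
Qed.

Definition nbhd (K : set (R * R)) (e : R) : set (R * R) :=
  \bigcup_(y in K) ball y e.

Lemma nbhd_open (K : set (R * R)) e : open (nbhd K e).
Proof. by apply: bigcup_open => y _; exact: ball_open. Qed.

(** The neighbourhoods of radius [1 / (n + 1)] of a compact set decrease to that
set and have finite measure, so continuity from above applies. *)
Lemma compact_measure_ge (K : set (R * R)) (b : \bar R) : compact K ->
  (forall e, 0 < e -> (b <= planar_lebesgue (nbhd K e))%E) ->
  (b <= planar_lebesgue K)%E.
Proof.
move=> cK bK.
pose V n := nbhd K n.+1%:R^-1.
have KV : \bigcap_n V n = K.
  apply/seteqP; split=> [x Vx|x Kx n _]; last first.
    by exists x => //; apply: ballxx; rewrite invr_gt0.
  have Kcl : closed K by apply: compact_closed cK; exact: norm_hausdorff.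
  apply: Kcl => B /nbhs_ballP[e /= e0 eB].
  have [n _ /(_ _ (leqnn n)) ne] := near_infty_natSinv_lt (PosNum e0).
  have [y Ky yx] := Vx n I; exists y; split=> //; apply: eB.
  by apply: ball_sym; apply: le_ball yx; exact: ltW.
have mV n : measurable (V n : set plane).
  by apply: open_measurable_plane; exact: nbhd_open.
have V0 : (mu (V 0%N) < +oo)%E.
  have [M [_ KM]] := compact_bounded cK.
  pose B := M + 1.
  have VB : V 0%N `<=` `[- (B + 1), B + 1] `*` `[- (B + 1), B + 1].
    move=> x [y Ky []]; rewrite invr1 /ball /= => x1 x2.
    have yB : `|y| <= B by apply: KM => //; rewrite /B ltrDl.
    move: yB; rewrite prod_normE ge_max => /andP[]; rewrite !ler_norml.
    move: x1 x2; rewrite !ltr_distl => /andP[? ?] /andP[? ?] /andP[? ?] /andP[? ?].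
    by split; rewrite /= in_itv/=; apply/andP; split; lra.
  have mI : measurable (`[- (B + 1), B + 1] : set (measurableTypeR R)).
    exact: measurable_itv.
  apply: (@le_lt_trans _ _ (mu (`[- (B + 1), B + 1] `*` `[- (B + 1), B + 1]))).
    by apply: le_measure => //; rewrite inE//; exact: measurableX.
  by rewrite product_measure1E//= lebesgue_measure_itv/=; case: ifP;
    rewrite ?mule0// -EFinD -EFinM ltry.
have Vcvg : (mu \o V) n @[n --> \oo] --> mu (\bigcap_n V n).
  apply: nonincreasing_cvg_mu => //.
    by apply: bigcapT_measurable.
  move=> m n mn; apply/subsetPset => x [y Ky yx]; exists y => //.
  by apply: le_ball yx; rewrite lef_pV2 ?posrE// ler_nat.
rewrite -KV; apply: (cvge_to_ge Vcvg); by apply: nearW => n; exact: bK.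
Qed.

End plane_topology.

(** * Mean values for one-sided derivatives *)

(** The first-order expansion form of [deriv_on]. Unlike a difference quotient
it makes sense at [y = x], and it survives restriction to a subset and the
translation of one function against another. *)
Definition expands_on (R : realType) (I : set R) (g g' : R -> R) : Prop :=
  forall x, I x -> forall e, 0 < e -> exists2 eta, 0 < eta &
    forall y, I y -> `|y - x| < eta ->
      `|g y - g x - g' x * (y - x)| <= e * `|y - x|.

Section one_variable.
Variable R : realType.
Implicit Types (I J : set R) (f g : R -> R).

Lemma deriv_on_expands I g g' : deriv_on I g g' -> expands_on I g g'.
Proof.
move=> gg' x Ix e e0.
have /cvgrPdist_lt /(_ e e0) := gg' x Ix.
rewrite /prop_near1 /within /= /dnbhs /within /= => /nbhs_ballP[eta /= eta0 etaP].
exists eta => // y Iy yx.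
have [->|yNx] := eqVneq y x; first by rewrite !subrr mulr0 subrr normr0 mulr0.
have := etaP y; rewrite /ball/= distrC => /(_ yx yNx Iy) h.
have yx0 : y - x != 0 by rewrite subr_eq0.
rewrite (_ : _ - _ - _ = - (g' x - (g y - g x) / (y - x)) * (y - x)).
  by rewrite normrM normrN ler_wpM2r// ltW.
by rewrite mulNr mulrBl opprB divfK.
Qed.

Lemma expands_onS I J g g' : J `<=` I -> expands_on I g g' -> expands_on J g g'.
Proof.
move=> JI gg' x Jx e e0; have [eta eta0 etaP] := gg' x (JI x Jx) e e0.
by exists eta => // y /JI; exact: etaP.
Qed.

Lemma expands_on_shift_diff I J g g' h : expands_on I g g' ->
  (forall x, J x -> I x /\ I (x - h)) ->
  expands_on J (fun x => g x - g (x - h)) (fun x => g' x - g' (x - h)).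
Proof.
move=> gg' JI x Jx e e0; have [Ix Ixh] := JI x Jx.
have e20 : 0 < e / 2 by lra.
have [a a0 aP] := gg' x Ix _ e20; have [b b0 bP] := gg' _ Ixh _ e20.
exists (Num.min a b); first by rewrite lt_min a0.
move=> y Jy; rewrite lt_min => /andP[ya yb]; have [Iy Iyh] := JI y Jy.
have := aP y Iy ya; have := bP (y - h) Iyh.
rewrite (_ : y - h - (x - h) = y - x); last by ring.
move=> /(_ yb) h1 h2.
rewrite (_ : _ - _ = (g y - g x - g' x * (y - x)) -
  (g (y - h) - g (x - h) - g' (x - h) * (y - x))); last by ring.
by rewrite (le_trans (ler_normB _ _))//; lra.
Qed.

Lemma expands_on_continuous I g g' : expands_on I g g' ->
  {within I, continuous g}.
Proof.
move=> gg'; apply/subspace_continuousP => x Ix; apply/cvgrPdist_lt => e e0.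
have [eta eta0 etaP] := gg' x Ix 1 ltr01.
have M0 : 0 < `|g' x| + 1 by rewrite ltr_wpDl.
rewrite /prop_near1 /within /=; apply/nbhs_ballP.
exists (Num.min eta (e / (`|g' x| + 1))) => /=.
  by rewrite lt_min eta0 divr_gt0.
move=> y; rewrite /ball/= distrC lt_min => /andP[y1 y2] Iy.
have := etaP y Iy y1; rewrite mul1r => h.
rewrite distrC; apply: le_lt_trans (_ : (`|g' x| + 1) * `|y - x| < e); last first.
  by rewrite mulrC -ltr_pdivlMr.
rewrite (_ : g y - g x = (g y - g x - g' x * (y - x)) + g' x * (y - x)); last by ring.
by rewrite (le_trans (ler_normD _ _))// normrM; lra.
Qed.

Lemma expands_on_is_derive (a b x : R) g g' : expands_on `[a, b] g g' ->
  x \in `]a, b[ -> is_derive x 1 g (g' x).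
Proof.
move=> gg' xab; have xI : x \in `[a, b] by exact: subset_itv_oo_cc xab.
move: xab; rewrite in_itv/= => /andP[ax xb].
suff h : (fun h => h^-1 *: ((g \o shift x) (h *: 1) - g x)) @ 0^' --> g' x.
  by apply: DeriveDef; [apply/cvg_ex; exists (g' x) | exact: cvg_lim h].
apply/cvgrPdist_lt => e e0.
have e20 : 0 < e / 2 by lra.
have [eta eta0 etaP] := gg' x xI _ e20.
rewrite /prop_near1 /dnbhs /within /=; apply/nbhs_ballP.
exists (Num.min eta (Num.min (x - a) (b - x))) => /=.
  by rewrite !lt_min eta0 /=; apply/andP; split; lra.
move=> h; rewrite /ball/= sub0r normrN !lt_min => /andP[h1 /andP[h2 h3]] hN0.
rewrite /shift /= /GRing.scale /= mulr1.
have := etaP (h + x); rewrite addrK /= in_itv /= => /(_ _ h1) hh.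
have h0 : 0 < `|h| by rewrite normr_gt0.
rewrite (_ : _ - _ = - (h^-1 * (g (h + x) - g x - g' x * h))); last first.
  by rewrite [in RHS]mulrBr opprB [h^-1 * (_ * h)]mulrCA mulVf// mulr1.
rewrite normrN normrM normfV mulrC ltr_pdivrMr//.
apply: le_lt_trans (hh _) _; last by rewrite ltr_pM2r//; lra.
by move: h2 h3; rewrite !ltr_norml => /andP[? ?] /andP[? ?]; apply/andP; split; lra.
Qed.

Lemma expands_on_MVT (a b : R) g g' : a < b -> expands_on `[a, b] g g' ->
  exists2 c, c \in `]a, b[ & g b - g a = g' c * (b - a).
Proof.
move=> ab gg'; apply: MVT => //; last exact: expands_on_continuous gg'.
by move=> x; exact: expands_on_is_derive.
Qed.

Lemma expands_on_lipschitz (a b L : R) g g' : expands_on `[a, b] g g' ->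
  (forall x, x \in `[a, b] -> `|g' x| <= L) ->
  forall x y, x \in `[a, b] -> y \in `[a, b] -> `|g x - g y| <= L * `|x - y|.
Proof.
move=> gg' g'L.
suff H x y : x \in `[a, b] -> y \in `[a, b] -> x < y ->
    `|g x - g y| <= L * `|x - y|.
  move=> x y xI yI; have [xy|xy|->] := ltgtP x y; first exact: H.
    by rewrite distrC (distrC x); exact: H.
  by rewrite !subrr normr0 mulr0.
rewrite !in_itv/= => /andP[ax xb] /andP[ay yb] xy.
have [] := @expands_on_MVT x y g g' xy.
  apply: expands_onS gg' => z /=; rewrite !in_itv/= => /andP[? ?].
  by apply/andP; split; lra.
move=> c; rewrite in_itv/= => /andP[xc cy] e.
rewrite distrC e normrM (distrC x) ler_wpM2r// g'L// in_itv/=.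
by apply/andP; split; lra.
Qed.

(** Mean value theorem twice: for [t |-> g t - g (t - h)] between [x] and [y],
then for [g'] over the step [h]. *)
Lemma second_difference_ge (a b c0 : R) g g' g'' :
  expands_on `[a, b] g g' -> expands_on `[a, b] g' g'' ->
  (forall x, x \in `[a, b] -> c0 <= `|g'' x|) ->
  forall h x y, x \in `[a, b] -> x - h \in `[a, b] -> y \in `[a, b] ->
    y - h \in `[a, b] ->
    c0 * `|h| * `|x - y| <= `|(g x - g (x - h)) - (g y - g (y - h))|.
Proof.
move=> gg' g'g'' c0g'' h.
have slope x : x \in `[a, b] -> x - h \in `[a, b] ->
    c0 * `|h| <= `|g' x - g' (x - h)|.
  move=> xI xhI.
  have key (u v : R) : u \in `[a, b] -> v \in `[a, b] -> u < v ->
      c0 * `|v - u| <= `|g' v - g' u|.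
    rewrite !in_itv/= => /andP[au ub] /andP[av vb] uv.
    have [] := @expands_on_MVT u v g' g'' uv.
      apply: expands_onS g'g'' => z /=; rewrite !in_itv/= => /andP[? ?].
      by apply/andP; split; lra.
    move=> z; rewrite in_itv/= => /andP[uz zv] ->.
    rewrite normrM ler_wpM2r// c0g''// in_itv/=.
    by apply/andP; split; lra.
  have [h0|h0|->] := ltgtP h 0.
  - have := key x (x - h) xI xhI ltac:(lra).
    have -> : x - h - x = - h by ring.
    by rewrite normrN distrC.
  - have := key (x - h) x xhI xI ltac:(lra).
    by have -> : x - (x - h) = h by ring.
  - by rewrite normr0 mulr0.
suff H x y : x \in `[a, b] -> x - h \in `[a, b] -> y \in `[a, b] ->
    y - h \in `[a, b] -> x < y ->
    c0 * `|h| * `|x - y| <= `|(g x - g (x - h)) - (g y - g (y - h))|.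
  move=> x y ? ? ? ?; have [xy|xy|->] := ltgtP x y; first exact: H.
    by rewrite distrC (distrC (g x - _)); exact: H.
  by rewrite !subrr normr0 mulr0.
rewrite !in_itv/= => /andP[? ?] /andP[? ?] /andP[? ?] /andP[? ?] xy.
have [] := @expands_on_MVT x y (fun x => g x - g (x - h))
                            (fun x => g' x - g' (x - h)) xy.
  apply: expands_on_shift_diff gg' _ => z /=; rewrite !in_itv/= => /andP[? ?].
  by split; apply/andP; split; lra.
move=> z; rewrite in_itv/= => /andP[? ?] e.
rewrite (distrC x) [leRHS]distrC e normrM ler_wpM2r// slope// in_itv/=.
  by apply/andP; split; lra.
by apply/andP; split; lra.
Qed.

End one_variable.

(** * Hausdorff measures of planar sets and of graphs *)

Section hausdorff.
Variable R : realType.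
Implicit Types (A B : set (R * R)) (x y : R * R).

Lemma edist_le x y : Defs.edist x y <= `|x.1 - y.1| + `|x.2 - y.2|.
Proof.
rewrite /Defs.edist -[leRHS]ger0_norm ?addr_ge0// -sqrtr_sqr ler_wsqrtr//.
rewrite [leRHS]sqrrD !real_normK ?num_real// addrAC lerDl.
by rewrite mulrn_wge0// mulr_ge0.
Qed.

Lemma diam_ge0 A : (0 <= diam A)%E.
Proof. by apply: ereal_sup_ubound; left. Qed.

Lemma diam_le A (b : R) : 0 <= b ->
  (forall x y, A x -> A y -> Defs.edist x y <= b) -> (diam A <= b%:E)%E.
Proof.
move=> b0 Ab; apply: ge_ereal_sup => _ [->|[x Ax [y Ay <-]]].
  by rewrite lee_fin.
by rewrite lee_fin Ab.
Qed.

Lemma diam_pow_ge0 s A : (0 <= diam_pow s A)%E.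
Proof. by rewrite /diam_pow; case: ifP => // _; exact: poweR_ge0. Qed.

Lemma diam_pow_le s A (b : R) : 0 <= s -> 0 <= b ->
  (forall x y, A x -> A y -> Defs.edist x y <= b) ->
  (diam_pow s A <= (b `^ s)%:E)%E.
Proof.
move=> s0 b0 Ab; rewrite /diam_pow; case: ifP => _.
  by rewrite lee_fin powR_ge0.
rewrite -poweR_EFin; apply: gt0_ler_poweR => //.
- by rewrite in_itv/= diam_ge0 leey.
- by rewrite in_itv/= lee_fin b0 leey.
- exact: diam_le.
Qed.

Lemma hausdorff_premeasure_ge0 s delta A : (0 <= hausdorff_premeasure s delta A)%E.
Proof.
apply: le_ereal_inf_tmp => _ [U _ <-]; apply: nneseries_ge0 => i _ _.
exact: diam_pow_ge0.
Qed.

Lemma hausdorff_measure_gt0 s A : hausdorff_measure s A <> 0%E ->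
  exists delta eta : R,
    [/\ 0 < delta, 0 < eta & (eta%:E <= hausdorff_premeasure s delta A)%E].
Proof.
move=> A0; apply: contrapT => nA; apply: A0; apply/eqP; rewrite eq_le.
apply/andP; split; last first.
  apply: le_trans (hausdorff_premeasure_ge0 s 1 A) _.
  by apply: ereal_sup_ubound; exists 1 => /=.
apply: ge_ereal_sup => _ [delta /= delta0 <-]; rewrite leNgt; apply/negP.
move h : (hausdorff_premeasure s delta A) => [r||] //= r0.
  by apply: nA; exists delta, r; rewrite h lexx -lte_fin.
by apply: nA; exists delta, 1; rewrite h leey.
Qed.

Lemma hausdorff_dim_gt A (t : R) : 0 <= t -> (t%:E < hausdorff_dim A)%E ->
  exists2 s : R, t < s & hausdorff_measure s A <> 0%E.
Proof.
move=> t0 tA.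
have [s ts sA] : exists2 s : R, t < s & (s%:E < hausdorff_dim A)%E.
  move: tA; case: (hausdorff_dim A) => [r| |]//.
    by rewrite lte_fin => tr; exists ((t + r) / 2); rewrite ?lte_fin; lra.
  by move=> _; exists (t + 1); [lra | rewrite ltry].
exists s => // sA0; move: sA; apply/negP; rewrite -leNgt.
by apply: ereal_inf_lbound; exists s => //=; split=> //; lra.
Qed.

(** A cover of [p + T] by intervals lifts to a cover of the graph over [T] whose
diameters are at most [1 + L] times the lengths. A cover of small total length
has only short intervals, so it is also admissible for the premeasure at scale
[delta]: this is why [tau] involves both [delta] and [eta]. The bound is uniform
in [p], which replaces the translation invariance of Lebesgue measure. *)
Lemma lipschitz_graph_translates (T : set R) (g : R -> R) (L delta eta : R) :
  0 <= L -> (forall t u, T t -> T u -> `|g t - g u| <= L * `|t - u|) ->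
  0 < delta -> 0 < eta ->
  (eta%:E <= hausdorff_premeasure 1 delta [set (t, g t) | t in T])%E ->
  exists2 tau : R, 0 < tau &
    forall p, (tau%:E <= lebesgue_measure [set x | T (x - p)%R])%E.
Proof.
move=> L0 gL delta0 eta0 etaT.
have L1 : 0 < 1 + L by lra.
pose tau := Num.min delta eta / (1 + L).
have tau0 : 0 < tau by rewrite divr_gt0// lt_min delta0.
have [tau1 tau2] : (1 + L) * tau <= delta /\ (1 + L) * tau <= eta.
  by rewrite /tau mulrC divfK ?gt_eqF// !ge_min !lexx orbT.
exists tau => // p; rewrite leNgt; apply/negP.
have -> : lebesgue_measure [set x | T (x - p)] =
  ereal_inf [set (\sum_(0 <= k <oo) wlength idfun (F k))%E
    | F in open_itv_cover [set x | T (x - p)]].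
  by rewrite -outer_measure_open_itv_cover.
move=> /ereal_inf_lt[_ [F [Fitv TF] <-]] Ftau.
have w0 k : (0 <= wlength idfun (F k))%E.
  by have [ab ->] := Fitv k; apply: wlength_itv_ge0.
have wtau k : (wlength idfun (F k) < tau%:E)%E.
  apply: le_lt_trans Ftau.
  apply: le_trans (_ : _ <= \sum_(0 <= i < k.+1) wlength idfun (F i))%E _.
    by rewrite big_nat_recr//= leeDr// sume_ge0.
  exact: nneseries_lim_ge.
have wfin k : wlength idfun (F k) \is a fin_num.
  by rewrite ge0_fin_numE// (lt_trans (wtau k))// ltry.
(* The graph points above the interval [F k - p]. *)
pose U k := [set (x - p, g (x - p)) | x in F k `&` [set x | T (x - p)]].
have Uw k : forall x y, U k x -> U k y ->
    Defs.edist x y <= (1 + L) * fine (wlength idfun (F k)).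
  move=> _ _ [x [Fx Tx] <-] [y [Fy Ty] <-].
  apply: le_trans (edist_le _ _) _ => /=.
  have xy : `|x - y| <= fine (wlength idfun (F k)).
    have [[a b] Fab] := Fitv k; move: Fx Fy; rewrite Fab /= !in_itv/=.
    move=> /andP[ax xb] /andP[ay yb]; rewrite wlength_itv_bnd/=; last by lra.
    by rewrite ler_norml; apply/andP; split; lra.
  apply: le_trans (_ : (1 + L) * `|x - y| <= _); last by rewrite ler_wpM2l// ltW.
  rewrite mulrDl mul1r; have := gL _ _ Tx Ty.
  have -> : x - p - (y - p) = x - y by ring.
  by move=> ?; lra.
have w0' k : 0 <= (1 + L) * fine (wlength idfun (F k)).
  by rewrite mulr_ge0 ?fine_ge0// ltW.
have Ucov : delta_cover delta [set (t, g t) | t in T] U.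
  split=> [_ [t Tt <-]|k].
    have Ttp : T (t + p - p) by rewrite addrK.
    have [k _ Fk] := TF (t + p) Ttp.
    by exists k => //; exists (t + p) => //=; rewrite addrK.
  apply: diam_le (ltW delta0) _ => x y Ux Uy; apply: le_trans (Uw k _ _ Ux Uy) _.
  apply: le_trans tau1; rewrite ler_wpM2l//; first exact: ltW.
  by rewrite -lee_fin fineK// ltW.
have : (hausdorff_premeasure 1 delta [set (t, g t) | t in T] < eta%:E)%E.
  apply: (@le_lt_trans _ _ (\sum_(0 <= i <oo) diam_pow 1 (U i))%E).
    by apply: ereal_inf_lbound; exists U.
  apply: (@le_lt_trans _ _ ((1 + L)%:E * \sum_(0 <= i <oo) wlength idfun (F i))%E).
    rewrite -nneseriesZl//; apply: lee_nneseries => [i _ _|i _].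
      exact: diam_pow_ge0.
    apply: le_trans (diam_pow_le ler01 (w0' i) (Uw i)) _.
    by rewrite powRr1// EFinM fineK.
  apply: (@lt_le_trans _ _ ((1 + L)%:E * tau%:E)%E).
    by rewrite lte_pmul2l// ?lte_fin.
  by rewrite -EFinM lee_fin.
by apply/negP; rewrite -leNgt.
Qed.

End hausdorff.

(** * Overlap of thin strips over a curved arc *)

Section strip.
Variable R : realType.
Notation plane := (measurableTypeR R * measurableTypeR R)%type.
Notation mu := (@lebesgue_measure R \x @lebesgue_measure R)%E.

(** The translate by [p] of the graph of [g] over [T], thickened upwards by
[delta]. *)
Definition strip (T : set R) (g : R -> R) (delta : R) (p : R * R) :
    set (R * R) :=
  [set z | T (z.1 - p.1) /\
    p.2 + g (z.1 - p.1) <= z.2 <= p.2 + g (z.1 - p.1) + delta].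

Lemma compact_translate_sum (A : set (R * R)) (a b : R) (p : R * R) :
  compact A ->
  compact [set p + (u.1 + (0, u.2)) | u in A `*` `[a, b]].
Proof.
move=> cA; apply: continuous_compact; last first.
  by apply: compact_setX => //; exact: segment_compact.
apply: continuous_subspaceT => u.
apply: (@cvgD _ (R * R)%type _ _ _ (fun=> p)); first exact: cvg_cst.
apply: (@cvgD _ (R * R)%type _ _ _ fst); first exact: cvg_fst.
apply: (@cvg_pair _ R R _ (nbhs (0 : R)) (nbhs u.2) _ _ _ (fun=> 0 : R) snd).
  exact: cvg_cst.
exact: cvg_snd.
Qed.

(** A strip is a translate of the vector sum of the graph and a vertical segment;
it is therefore compact when the graph is. *)
Lemma stripE (T : set R) (g : R -> R) (delta : R) (p : R * R) :
  strip T g delta p =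
  [set p + (u.1 + (0, u.2)) | u in [set (t, g t) | t in T] `*` `[0, delta]].
Proof.
apply/seteqP; split=> [z [Tz]|_ [[_ s] [/= [t Tt <-]]] + <-].
  move=> /andP[z1 z2]; exists ((z.1 - p.1, g (z.1 - p.1)),
    z.2 - p.2 - g (z.1 - p.1)).
    split; first by exists (z.1 - p.1).
    by rewrite /= in_itv/=; apply/andP; split; lra.
  rewrite [LHS]surjective_pairing [RHS]surjective_pairing /=.
  by congr pair; ring.
rewrite in_itv/= => /andP[s0 sd]; rewrite /strip /=.
have -> : p.1 + (t + 0) - p.1 = t by ring.
by split=> //; apply/andP; split; lra.
Qed.

Lemma strip_measurable (T : set R) (g : R -> R) (delta : R) (p : R * R) :
  compact [set (t, g t) | t in T] -> measurable (strip T g delta p : set plane).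
Proof.
by move=> cT; rewrite stripE; apply: compact_measurable_plane;
  exact: compact_translate_sum.
Qed.

Lemma compact_translate_fst (T : set R) (g : R -> R) (p : R) :
  compact [set (t, g t) | t in T] -> compact [set x | T (x - p)].
Proof.
move=> cT.
have -> : [set x | T (x - p)] =
    (fun u : R * R => p + u.1) @` [set (t, g t) | t in T].
  apply/seteqP; split=> [x Tx|_ [_ [t Tt <-] <-]] /=.
    by exists (x - p, g (x - p)); [exists (x - p) | rewrite /=; ring].
  by have -> : p + t - p = t by ring.
apply: continuous_compact cT; apply: continuous_subspaceT => u.
by apply: cvgD; [exact: cvg_cst | exact: cvg_fst].
Qed.

Lemma strip_measure_ge (T : set R) (g : R -> R) (delta : R) (p : R * R) :
  compact [set (t, g t) | t in T] -> 0 <= delta ->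
  (delta%:E * lebesgue_measure [set x | T (x - p.1)%R] <=
   mu (strip T g delta p))%E.
Proof.
move=> cT delta0; set B := [set x | T (x - p.1)].
have mB : measurable (B : set (measurableTypeR R)).
  apply: closed_measurable; apply: compact_closed; first exact: norm_hausdorff.
  exact: compact_translate_fst cT.
have mS := strip_measurable delta p cT.
rewrite -integral_scaled_indic//; apply: ge0_le_integral => //.
- by move=> x _; rewrite lee_fin mulr_ge0.
- exact: measurable_scaled_indic.
- exact: measurable_fun_xsection.
move=> x _; rewrite indicE /=; case: (boolP (x \in B)) => [|_]; last by rewrite mulr0.
rewrite inE mulr1 => Bx.
rewrite (_ : xsection _ x =
    `[p.2 + g (x - p.1), p.2 + g (x - p.1) + delta]%classic).
  rewrite lebesgue_measure_itv/= lte_fin; case: ltP => h; rewrite lee_fin; lra.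
apply/seteqP; split=> y /=.
  by move=> /xsectionP[_]; rewrite in_itv.
by rewrite in_itv/= => yI; apply/xsectionP.
Qed.

(** Fubini: the abscissas of [W] lie within [rho] of any one of them, and every
vertical section has length at most [delta]. *)
Lemma thin_measure_le (W : set (R * R)) (f : R -> R) (delta rho : R) :
  measurable (W : set plane) -> 0 <= delta -> 0 <= rho ->
  (forall z, W z -> f z.1 <= z.2 <= f z.1 + delta) ->
  (forall z z', W z -> W z' -> `|z.1 - z'.1| <= rho) ->
  (mu W <= (2 * rho * delta)%:E)%E.
Proof.
move=> mW delta0 rho0 Wf Wrho.
have [[z0 Wz0]|W0] := pselect (W !=set0); last first.
  rewrite (_ : W = set0) ?measure0 ?lee_fin ?mulr_ge0//.
  by apply/eqP/negPn/negP => /set0P.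
pose B : set (measurableTypeR R) := `[z0.1 - rho, z0.1 + rho]%classic.
have mB : measurable B by exact: measurable_itv.
rewrite (_ : (2 * rho * delta)%:E = delta%:E * lebesgue_measure B)%E; last first.
  rewrite lebesgue_measure_itv/= lte_fin; case: ltP => h.
    by rewrite -EFinB -EFinM; congr EFin; ring.
  rewrite mule0; have -> : rho = 0 by lra.
  by rewrite mulr0 mul0r.
rewrite -integral_scaled_indic//; apply: ge0_le_integral => //.
- exact: measurable_fun_xsection.
- exact: measurable_scaled_indic.
move=> x _; rewrite indicE /=; case: (boolP (x \in B)) => [_|xB]; last first.
  rewrite (_ : xsection W x = set0) ?measure0 ?mulr0//.
  rewrite -subset0 => y /xsectionP Wxy.
  move: xB; apply/negP/negPn; rewrite inE /B/= in_itv/=.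
  by move: (Wrho _ _ Wxy Wz0); rewrite /= ler_distl; move=> /andP[? ?]; apply/andP; split; lra.
rewrite mulr1.
apply: (@le_trans _ _ (lebesgue_measure (`[f x, f x + delta]%classic : set R))).
  apply: le_measure; rewrite ?inE//; first exact: measurable_xsection.
  by move=> y /xsectionP /Wf /=; rewrite in_itv.
by rewrite lebesgue_measure_itv/= lte_fin; case: ltP => h; rewrite lee_fin; lra.
Qed.

Definition side (l : R) (k : nat) : R := l / 2 ^+ k.

Lemma side_gt0 l k : 0 < l -> 0 < side l k.
Proof. by move=> l0; rewrite divr_gt0// exprn_gt0. Qed.

Lemma sideS l k : side l k = 2 * side l k.+1.
Proof. by rewrite /side exprS; field; rewrite expf_eq0 andbC pnatr_eq0. Qed.

(** [a] is either below the finest scale or of the order of a single dyadic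
side. *)
Lemma side_search l (a : R) n : a <= 2 * side l 0 ->
  a <= 2 * side l n \/ exists2 k, (k < n)%N & side l k < a <= 2 * side l k.
Proof.
move=> a0; elim: n => [|n ih]; first by left.
have [an|an] := leP a (2 * side l n.+1); first by left.
right; case: ih => [an'|[k kn ak]]; last by exists k => //; exact: ltnW.
by exists n; rewrite // an' sideS an.
Qed.

(** Dyadic form of the truncated Riesz kernel [1 / max(|z|, side l n)], to which
it is comparable when [|z| <= 2 * side l 0]. As a sum of indicators of balls
it is easily integrated against weights whose mass on balls is known. *)
Definition kernel_sum (l : R) (n : nat) (z : R * R) : R :=
  \sum_(k < n.+1) (if `|z| <= 2 * side l k then (side l k)^-1 else 0).

Lemma kernel_sum_ge l n z k : 0 < l -> (k <= n)%N -> `|z| <= 2 * side l k ->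
  (side l k)^-1 <= kernel_sum l n z.
Proof.
move=> l0 kn zk; have kn' : (k < n.+1)%N by [].
rewrite /kernel_sum (bigD1 (Ordinal kn'))//= zk lerDl.
apply: sumr_ge0 => i _; case: ifP => // _.
by rewrite invr_ge0 ltW// side_gt0.
Qed.

(** The curvature estimate, with [h = q.1 - p.1]. If [q - p] is of the order of
[delta], the trivial bound by the measure of one strip suffices. Otherwise
[second_difference_ge] confines the abscissas of the overlap to a length
[2 * delta / (c0 * |h|)], and the Lipschitz bound shows that two strips can
meet only if [|h|] is comparable to [|q - p|]. *)
Lemma strip_overlap_le (c d c0 L l : R) (g g' g'' : R -> R) (T : set R) (n : nat)
    (p q : R * R) :
  c < d -> expands_on `[c, d] g g' -> expands_on `[c, d] g' g'' ->
  0 < c0 -> (forall x, x \in `[c, d] -> c0 <= `|g'' x|) ->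
  1 <= L -> (forall x, x \in `[c, d] -> `|g' x| <= L) ->
  T `<=` `[c, d] -> compact [set (t, g t) | t in T] -> 0 < l ->
  `|q - p| <= 2 * side l 0 ->
  (mu (strip T g (side l n) p `&` strip T g (side l n) q) <=
   ((2 * (d - c) + 8 * L / c0) * side l n ^+ 2 *
     kernel_sum l n (q - p))%:E)%E.
Proof.
move=> cd gg' g'g'' c00 c0g'' L1 g'L Tcd cT l0 pq.
have s0 := side_gt0 n l0; set delta := side l n in s0 *.
have dc0 : 0 <= d - c by lra.
have Lc0 : 0 <= 8 * L / c0 by rewrite divr_ge0//; lra.
set W := _ `&` _.
have mW : measurable (W : set plane) by apply: measurableI; exact: strip_measurable.
have Wg z : W z -> p.2 + g (z.1 - p.1) <= z.2 <= p.2 + g (z.1 - p.1) + delta.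
  by move=> [[]].
pose C := 2 * (d - c) + 8 * L / c0.
have ker k rho : 0 <= rho -> (k <= n)%N -> `|q - p| <= 2 * side l k ->
    2 * rho <= C * delta / side l k ->
    (forall z z', W z -> W z' -> `|z.1 - z'.1| <= rho) ->
    (mu W <= (C * delta ^+ 2 * kernel_sum l n (q - p))%:E)%E.
  move=> rho0 kn pqk rhoC Wrho.
  have := @thin_measure_le W (fun x => p.2 + g (x - p.1)) _ _ mW (ltW s0) rho0
    Wg Wrho.
  move=> /le_trans; apply; rewrite lee_fin.
  apply: le_trans (_ : C * delta ^+ 2 / side l k <= _); last first.
    by rewrite ler_wpM2l ?kernel_sum_ge// mulr_ge0 ?sqr_ge0// addr_ge0// mulr_ge0.
  rewrite expr2 (_ : _ / side l k = C * delta / side l k * delta); last by ring.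
  by rewrite ler_wpM2r// ltW.
have [pqn|[k kn /andP[kpq pqk]]] := side_search n pq.
  apply: (ker n (d - c)) => //.
    by rewrite -/delta mulfK ?gt_eqF// lerDl.
  move=> z z' [[/Tcd + _] _] [[/Tcd + _] _]; rewrite /= !in_itv/=.
  move=> /andP[? ?] /andP[? ?]; rewrite ler_norml.
  by apply/andP; split; lra.
set h := q.1 - p.1; set v := q.2 - p.2.
have qp : `|q - p| = Num.max `|h| `|v| by [].
have sk0 := side_gt0 k l0.
have skn : 2 * delta <= side l k.
  rewrite /delta; elim: (n) kn => // m ih; rewrite ltnS leq_eqVlt => /orP[/eqP ->|/ih].
    by rewrite -sideS.
  by rewrite (sideS _ m); have := side_gt0 m.+1 l0; lra.
have [[z1 Wz1]|W0] := pselect (W !=set0); last first.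
  rewrite (_ : W = set0) ?measure0; last first.
    by apply/eqP/negPn/negP => /set0P.
  rewrite lee_fin mulr_ge0//; last first.
    by apply: le_trans (kernel_sum_ge _ (ltnW kn) pqk) => //; rewrite invr_ge0 ltW.
  by rewrite mulr_ge0 ?sqr_ge0// addr_ge0// mulr_ge0.
have Wdiff z : W z -> let t := z.1 - p.1 in
    [/\ t \in `[c, d], t - h \in `[c, d] &
        `|g t - g (t - h) - v| <= delta].
  move=> [[zp /andP[p1 p2]] [zq /andP[q1 q2]]] /=.
  have th : z.1 - p.1 - h = z.1 - q.1 by rewrite /h; ring.
  rewrite th; split; [exact: Tcd | exact: Tcd |].
  by rewrite ler_norml /v; apply/andP; split; lra.
(* Strips that meet are not above one another: when the vertical offset
   dominates, [|v| <= L * |h| + delta] and [2 * delta <= side l k < |v|]. *)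
have hpos : side l k < 2 * L * `|h|.
  have [tI thI tv] := Wdiff _ Wz1.
  have := expands_on_lipschitz gg' g'L tI thI.
  rewrite (_ : _ - (_ - h) = h); last by ring.
  move: (g _) (g _) tv => x y; rewrite ler_distl => /andP[tv1 tv2].
  rewrite ler_norml => /andP[xy1 xy2].
  have hL : `|h| <= L * `|h| by rewrite ler_peMl.
  have h0 : 0 <= `|h| by [].
  have vle : `|v| <= L * `|h| + delta.
    by rewrite ler_norml; apply/andP; split; lra.
  move: kpq; rewrite qp lt_max => /orP[|]; lra.
have h0 : 0 < `|h|.
  by rewrite -(pmulr_rgt0 _ (_ : 0 < 2 * L)); lra.
apply: (ker k (2 * delta / (c0 * `|h|))) => //.
- by rewrite divr_ge0// mulr_ge0// ltW.
- exact: ltnW.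
- rewrite (_ : 2 * (2 * delta / (c0 * `|h|)) = 4 * delta / c0 * `|h|^-1); last first.
    by field; rewrite !gt_eqF.
  have hk : `|h|^-1 <= 2 * L / side l k.
    by rewrite ler_pdivlMr// mulrC ler_pdivrMr// ltW.
  apply: le_trans (_ : 4 * delta / c0 * (2 * L / side l k) <= _).
    by rewrite ler_wpM2l// divr_ge0//; lra.
  rewrite (_ : 4 * delta / c0 * (2 * L / side l k) =
      8 * L / c0 * (delta / side l k)); last by field; rewrite !gt_eqF.
  rewrite -[leRHS]mulrA ler_wpM2r ?divr_ge0 ?ltW// /C; lra.
move=> z z' Wz Wz'.
have [tI thI tv] := Wdiff _ Wz; have [tI' thI' tv'] := Wdiff _ Wz'.
have := second_difference_ge gg' g'g'' c0g'' tI thI tI' thI'.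
rewrite (_ : z.1 - p.1 - (z'.1 - p.1) = z.1 - z'.1); last by ring.
rewrite ler_pdivlMr ?mulr_gt0// mulrC => /le_trans; apply.
move: (g _ - g _) (g _ - g _) tv tv' => x y.
rewrite !ler_distl => /andP[? ?] /andP[? ?].
by apply/andP; split; lra.
Qed.

End strip.

(** * The dyadic grid of the plane and the energy of its weights *)

Section grid.
Variable R : realType.

Lemma floor_half (u v : R) : Num.floor u = Num.floor v ->
  Num.floor (u / 2) = Num.floor (v / 2).
Proof.
move=> uv; apply: floor_def; set m := Num.floor (v / 2).
have /andP[mv vm] := floor_itv (v / 2); rewrite -/m in mv vm.
have mu : (m * 2)%:~R <= u.
  by rewrite -floor_ge_int uv floor_ge_int intrM; lra.
have um : u < ((m + 1) * 2)%:~R.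
  by rewrite -floor_lt_int uv floor_lt_int intrM; lra.
by rewrite !intrM in mu um; apply/andP; split; lra.
Qed.

Lemma floor_double (u : R) (m : int) : Num.floor (u / 2) = m ->
  Num.floor u \in [:: m * 2; m * 2 + 1].
Proof.
move=> um; have /andP[mu mu'] := floor_itv (u / 2); rewrite um in mu mu'.
have h1 : m * 2 <= Num.floor u by rewrite floor_ge_int intrM; lra.
have h2 : Num.floor u < (m + 1) * 2 by rewrite floor_lt_int intrM; lra.
rewrite !inE; lia.
Qed.

Lemma floor_near (u v : R) : `|u - v| <= 2 ->
  Num.floor u \in [seq Num.floor v + i | i <- [:: -2; -1; 0; 1; 2]].
Proof.
rewrite ler_norml => /andP[uv1 uv2].
have /andP[v1 v2] := floor_itv v.
have h1 : Num.floor v - 2 <= Num.floor u by rewrite floor_ge_int intrB; lra.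
have h2 : Num.floor u < Num.floor v + 1 + 2 by rewrite floor_lt_int intrD; lra.
rewrite !inE; lia.
Qed.

Definition grid_cell (a l : R) (k : nat) (p : R * R) : int * int :=
  (Num.floor ((p.1 - a) / side l k), Num.floor ((p.2 - a) / side l k)).

Variables (a l : R).
Hypothesis l0 : 0 < l.
Local Notation cell := (grid_cell a l).

Let half (u : R) k : u / side l k = (u / side l k.+1) / 2.
Proof.
have := side_gt0 k.+1 l0; rewrite (sideS l k) => h.
by field; rewrite gt_eqF.
Qed.

Lemma grid_cell_refine k x y : cell k.+1 x = cell k.+1 y -> cell k x = cell k y.
Proof.
by rewrite /grid_cell !(half _ k) => -[/floor_half -> /floor_half ->].
Qed.

Lemma grid_cell_finite k (q : int * int) : exists cs : seq (int * int),
  forall x, cell k x = q -> cell k.+1 x \in cs.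
Proof.
exists [seq (i, j) | i <- [:: q.1 * 2; q.1 * 2 + 1],
                     j <- [:: q.2 * 2; q.2 * 2 + 1]] => x.
rewrite /grid_cell !(half _ k) => <-.
by apply: allpairs_f; exact: floor_double.
Qed.

Lemma grid_cell_edist k x y : cell k x = cell k y ->
  Defs.edist x y <= 2 * side l k.
Proof.
rewrite /grid_cell; move: (side l k) (side_gt0 k l0) => r r0.
have H (u v : R) : Num.floor ((u - a) / r) = Num.floor ((v - a) / r) ->
    `|u - v| <= r.
  move=> uv; have /andP[] := floor_itv ((u - a) / r).
  have /andP[] := floor_itv ((v - a) / r); rewrite uv !intrD.
  rewrite !ler_pdivlMr// !ltr_pdivrMr// => v1 v2 u1 u2.
  by rewrite ler_norml; apply/andP; split; lra.
case=> /H h1 /H h2; apply: le_trans (edist_le _ _) _; lra.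
Qed.

Lemma grid_cell_near k x y : `|x - y| <= 2 * side l k -> cell k x \in
  [seq (i, j) | i <- [seq (cell k y).1 + i | i <- [:: -2; -1; 0; 1; 2]],
                j <- [seq (cell k y).2 + i | i <- [:: -2; -1; 0; 1; 2]]].
Proof.
rewrite /grid_cell; move: (side l k) (side_gt0 k l0) => r s0.
rewrite prod_normE ge_max => /andP[x1 x2]; rewrite /= in x1 x2; apply: allpairs_f; apply: floor_near.
  rewrite -mulrBl (_ : x.1 - a - (y.1 - a) = x.1 - y.1); last by ring.
  by rewrite normrM normfV (gtr0_norm s0) ler_pdivrMr.
rewrite -mulrBl (_ : x.2 - a - (y.2 - a) = x.2 - y.2); last by ring.
by rewrite normrM normfV (gtr0_norm s0) ler_pdivrMr.
Qed.

(** A ball of radius [2 * side l k] for the max norm meets at most the 25 cells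
whose indices differ by at most 2 from those of its centre. *)
Lemma grid_mass_ball (D : set (R * R)) (w : seq ((R * R) * {nonneg R}))
    (k : nat) (b : R) (p : R * R) : weights_on D w ->
  (forall q, mass w (fun x => cell k x == q) <= b) ->
  mass w (fun x => `|x - p| <= 2 * side l k) <= 25 * b.
Proof.
move=> wD wb.
have := mass_mem_le
  [seq (i, j) | i <- [seq (cell k p).1 + i | i <- [:: -2; -1; 0; 1; 2]],
                j <- [seq (cell k p).2 + i | i <- [:: -2; -1; 0; 1; 2]]] wD wb.
rewrite size_allpairs !size_map /=; apply: le_trans.
by apply: mass_le wD _ => x _; exact: grid_cell_near.
Qed.

Lemma side_powR_geometric (t : R) : 0 < t ->
  exists2 M, 0 < M & forall n, \sum_(k < n) side l k `^ t <= M.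
Proof.
move=> t0; pose x : R := 2^-1 `^ t.
have x0 : 0 < x by rewrite powR_gt0// invr_gt0.
have x1 : x < 1.
  have -> : 1 = 1 `^ t :> R by rewrite powR1.
  by apply: gt0_ltr_powR; rewrite ?nnegrE ?invr_ge0 ?invf_lt1 ?ltr1n.
exists (l `^ t / (1 - x)).
  by rewrite divr_gt0// ?powR_gt0// subr_gt0.
have xE k : (2^-1 ^+ k : R) `^ t = x ^+ k.
  by rewrite -[2^-1 ^+ k]powR_mulrn ?invr_ge0// -powRrM mulrC powRrM powR_mulrn// powR_ge0.
move=> n; have := @geometric_le_lim R n (l `^ t) x (powR_ge0 _ _) x0.
rewrite gtr0_norm// => /(_ x1); apply: le_trans; rewrite /series /= big_mkord.
apply: ler_sum => k _; rewrite /side /geometric /= powRM ?(ltW l0)//.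
  by rewrite -exprVn xE.
Qed.

(** The potential of the weights at [p]. The annulus of level [k] contributes
[(side l k)^-1] times the mass of a ball of radius [2 * side l k], that is at
most [25 * side l k `^ (s - 1)]. *)
Lemma weights_sum_kernel (D : set (R * R)) (w : seq ((R * R) * {nonneg R}))
    (n : nat) (s M : R) (p : R * R) : weights_on D w ->
  (forall k q, (k <= n)%N -> mass w (fun x => cell k x == q) <= side l k `^ s) ->
  \sum_(k < n.+1) side l k `^ (s - 1) <= M ->
  \sum_(z <- w) z.2%:num * kernel_sum l n (z.1 - p) <= 25 * M.
Proof.
move=> wD wr sM.
apply: le_trans (_ : 25 * \sum_(k < n.+1) side l k `^ (s - 1) <= _); last first.
  by rewrite ler_wpM2l.
rewrite mulr_sumr.
rewrite (eq_bigr (fun z => \sum_(k < n.+1)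
    (if `|z.1 - p| <= 2 * side l k then (side l k)^-1 * z.2%:num else 0))); last first.
  move=> z _; rewrite mulr_sumr; apply: eq_bigr => k _.
  by case: ifP => _; [rewrite mulrC | rewrite mulr0].
rewrite exchange_big; apply: ler_sum => k _ /=.
have s0 := side_gt0 k l0.
rewrite -big_mkcond /= -mulr_sumr.
rewrite powRB; last by rewrite (gt_eqF s0) implybT.
rewrite powRr1 ?(ltW s0)// mulrA mulrC ler_wpM2r ?invr_ge0 ?(ltW s0)//.
by apply: (grid_mass_ball _ wD) => q; apply: wr; rewrite -ltnS.
Qed.

End grid.

(** * Lower bounds for measures of unions *)

Section content.
Variables (R : realType) (E : set (R * R)) (a l : R).
Hypothesis l0 : 0 < l.
Local Notation cell := (grid_cell a l).

(** A finite cover by cells either uses a cell that is large compared with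
[delta], whose cost alone is bounded below, or is admissible for the
Hausdorff premeasure at scale [delta]. A cell of side [r] is counted with
diameter [2 * r]. *)
Lemma grid_content_ge (s delta eta : R) : 0 < s -> 0 < delta -> 0 < eta ->
  (eta%:E <= hausdorff_premeasure s delta E)%E ->
  exists2 kappa, 0 < kappa & forall cov : seq (nat * (int * int)),
    (forall x, E x -> exists2 c, c \in cov & cell c.1 x = c.2) ->
    kappa <= \sum_(c <- cov) side l c.1 `^ s.
Proof.
move=> s0 delta0 eta0 etaE.
have d20 : 0 < delta / 2 by lra.
exists (Num.min ((delta / 2) `^ s) (eta / 2 `^ s)).
  by rewrite lt_min divr_gt0 ?powR_gt0.
move=> cov Ecov; rewrite ge_min.
have [/hasP[c cc cdelta]|small] := boolP (has (fun c => delta < 2 * side l c.1) cov).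
  apply/orP; left; rewrite (big_rem c)//=.
  apply: le_trans (_ : side l c.1 `^ s <= _); last first.
    by rewrite lerDl sumr_ge0// => i _; exact: powR_ge0.
  apply: ge0_ler_powR; rewrite ?nnegrE; try exact: ltW.
  - by rewrite ltW// side_gt0.
  - by lra.
apply/orP; right; rewrite ler_pdivrMr ?powR_gt0//.
pose piece (c : nat * (int * int)) := E `&` [set x | cell c.1 x = c.2].
pose U i := nth set0 [seq piece c | c <- cov] i.
have diamU c x y : piece c x -> piece c y -> Defs.edist x y <= 2 * side l c.1.
  by move=> [_ /= xc] [_ /= yc]; apply: (@grid_cell_edist _ a) => //; rewrite xc yc.
have s20 k : 0 <= 2 * side l k by rewrite mulr_ge0// ltW// side_gt0.
have UE : delta_cover delta E U.
  split=> [x Ex|i].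
    have [c cc xc] := Ecov x Ex.
    exists (index c cov) => //; rewrite /U (nth_map c) ?index_mem// nth_index//.
  have [icov|icov] := ltnP i (size cov); last first.
    by rewrite /U nth_default ?size_map//; apply: diam_le => //; exact: ltW.
  rewrite /U (nth_map (0%N, (0, 0)))//; set c := nth _ _ _.
  apply: diam_le => [|x y px py]; first exact: ltW.
  apply: le_trans (diamU _ _ _ px py) _.
  by rewrite leNgt; apply: contra small => h; apply/hasP; exists c => //; exact: mem_nth.
rewrite -lee_fin; apply: (le_trans etaE).
apply: (@le_trans _ _ (\sum_(0 <= i <oo) diam_pow s (U i))%E).
  by apply: ereal_inf_lbound; exists U.
rewrite (nneseries_split 0 (size cov)); last by move=> k _; exact: diam_pow_ge0.
rewrite [X in (_ + X)%E]eseries0; last first.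
  move=> i ic _; rewrite /U nth_default ?size_map ?add0n//.
  by rewrite /diam_pow eqxx.
rewrite adde0 add0n -(size_map piece cov).
rewrite -(big_nth set0 xpredT (fun V => diam_pow s V)) big_map mulr_suml -sumEFin.
apply: lee_sum => c _.
apply: le_trans (diam_pow_le (ltW s0) (s20 c.1) (@diamU c)) _.
by rewrite lee_fin powRM ?(ltW (side_gt0 _ l0))// mulrC.
Qed.

End content.

Lemma lee_sum_on (R : realType) (X : Type) (D : set X)
    (w : seq (X * {nonneg R})) (F G : X * {nonneg R} -> \bar R) :
  weights_on D w -> (forall z, D z.1 -> F z <= G z)%E ->
  (\sum_(z <- w) F z <= \sum_(z <- w) G z)%E.
Proof.
move=> + FG; elim=> [|z w' Dz _ ih]; first by rewrite !big_nil.
by rewrite !big_cons leeD// FG.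
Qed.

Lemma compact_minkowski_sum (R : realType) (A B : set (R * R)) :
  compact A -> compact B -> compact (minkowski_sum A B).
Proof.
move=> cA cB.
rewrite (_ : minkowski_sum A B =
    (fun u : (R * R) * (R * R) => u.1 + u.2) @` (A `*` B)).
  apply: continuous_compact; last exact: compact_setX.
  apply: continuous_subspaceT => u.
  by apply: (@cvgD _ (R * R)%type _ _ _ fst snd); [exact: cvg_fst | exact: cvg_snd].
apply/seteqP; split=> [_ [x Ax [y By <-]]|_ [[x y] [/= Ax By] <-]].
  by exists (x, y).
by exists x => //; exists y.
Qed.

(** The half-open root square is larger than the bounding square of [E], so that
the points on the upper sides of the latter have index [(0, 0)] too. *)
Lemma compact_in_root_cell (R : realType) (E : set (R * R)) : compact E ->
  exists a l : R, 0 < l /\ forall x, E x ->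
    grid_cell a l 0 x = (0, 0) /\ forall y, E y -> `|x - y| <= 2 * side l 0.
Proof.
move=> cE; have [M [_ KM]] := compact_bounded cE.
pose B := `|M| + 1.
have B0 : 0 < B by rewrite ltr_wpDl.
have EB x : E x -> `|x| <= B.
  by apply: KM; rewrite /B (le_lt_trans (ler_norm M))// ltrDl.
have EB12 x : E x -> - B <= x.1 <= B /\ - B <= x.2 <= B.
  by move=> /EB; rewrite prod_normE ge_max -!ler_norml => /andP[].
have s0 : side (2 * B + 1) 0 = 2 * B + 1 by rewrite /side expr0 divr1.
exists (- B), (2 * B + 1); split; first by lra.
move=> x Ex; have [/andP[? ?] /andP[? ?]] := EB12 x Ex; split.
  rewrite /grid_cell s0; congr pair; apply: floor_def.
    by rewrite ler_pdivlMr ?ltr_pdivrMr; [apply/andP; split| |]; lra.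
  by rewrite ler_pdivlMr ?ltr_pdivrMr; [apply/andP; split| |]; lra.
move=> y Ey; rewrite s0 (le_trans (ler_normB _ _))//.
by have := EB x Ex; have := EB y Ey; lra.
Qed.

Section energy.
Variables (R : realType) (a l : R).
Hypothesis l0 : 0 < l.
Local Notation cell := (grid_cell a l).
Notation plane := (measurableTypeR R * measurableTypeR R)%type.
Notation mu := (@lebesgue_measure R \x @lebesgue_measure R)%E.

(** The second-moment bound, for any sets [S p] whose measures and overlaps
behave like those of strips of thickness [side l n]. *)
Lemma union_measure_ge (E U : set (R * R)) (S : R * R -> set (R * R))
    (w : seq ((R * R) * {nonneg R})) (n : nat) (s M C m : R) :
  (forall k q, (k <= n)%N -> mass w (fun x => cell k x == q) <= side l k `^ s) ->
  \sum_(k < n.+1) side l k `^ (s - 1) <= M ->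
  0 < C -> 0 < M -> 0 < m -> weights_on E w ->
  (forall p, measurable (S p : set plane)) -> (forall p, E p -> S p `<=` U) ->
  measurable (U : set plane) ->
  (forall p, ((m * side l n)%:E <= mu (S p))%E) ->
  (forall p q, E p -> E q -> (mu (S p `&` S q) <=
     (C * side l n ^+ 2 * kernel_sum l n (q - p))%:E)%E) ->
  ((mass w xpredT * m ^+ 2 / (25 * C * M))%:E <= mu U)%E.
Proof.
move=> wr sM C0 M0 m0 wE mS SU mU Sm SS.
have := side_gt0 n l0; move: (side l n) Sm SS => delta Sm SS delta0.
pose D := 25 * C * M; have D0 : 0 < D by rewrite !mulr_gt0.
pose W := mass w xpredT.
(* The optimal parameter: the bound on [\int F^2] divided by that on [\int F]. *)
have lam0 : 0 <= D * delta / m by rewrite divr_ge0 ?mulr_ge0// ltW.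
have := @weighted_cauchy_schwarz _ plane R mu _ w E S U (NngNum lam0) wE mS SU mU.
set Q := (\sum_(z <- w) \sum_(z' <- w) _)%E.
have QW : (Q <= (D * delta ^+ 2 * W)%:E)%E.
  rewrite /W /mass mulr_sumr -sumEFin; apply: (lee_sum_on wE) => z Ez.
  apply: le_trans (_ : _ <= \sum_(z' <- w) (z.2%:num * (C * delta ^+ 2) *
      (z'.2%:num * kernel_sum l n (z'.1 - z.1)))%:E)%E _.
    apply: (lee_sum_on wE) => z' Ez'.
    apply: le_trans (lee_wpmul2l _ (SS _ _ Ez Ez')) _; first by rewrite lee_fin.
    by rewrite -EFinM lee_fin le_eqVlt; apply/orP; left; apply/eqP; ring.
  rewrite sumEFin lee_fin -mulr_sumr.
  apply: le_trans (ler_wpM2l _ (weights_sum_kernel l0 _ wE wr sM)) _.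
    by rewrite mulr_ge0// mulr_ge0 ?sqr_ge0// ltW.
  by rewrite le_eqVlt /D; apply/orP; left; apply/eqP; ring.
have lower : ((2 * (D * delta / m) * (m * delta) * W)%:E <=
    \sum_(z <- w) (2 * (NngNum lam0)%:num * z.2%:num)%:E * mu (S z.1))%E.
  rewrite /W /mass mulr_sumr -sumEFin; apply: (lee_sum_on wE) => z Ez.
  apply: le_trans (_ : _ <= (2 * (D * delta / m) * z.2%:num)%:E * (m * delta)%:E)%E _.
    by rewrite -EFinM lee_fin le_eqVlt; apply/orP; left; apply/eqP; ring.
  by apply: lee_wpmul2l; rewrite // lee_fin mulr_ge0// mulr_ge0.
move=> /(le_trans lower) /le_trans /(_ (leeD2r _ QW)) /=.
have : (0 <= mu U)%E by exact: measure_ge0.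
case: (mu U) => [u||] //; last by move=> *; rewrite leey.
rewrite !lee_fin => u0 h.
have mN0 : m != 0 by rewrite gt_eqF.
have h2 : D * delta ^+ 2 * W <= (D * delta / m) ^+ 2 * u.
  have e : 2 * (D * delta / m) * (m * delta) * W = 2 * (D * delta ^+ 2 * W).
    by field.
  by rewrite e in h; lra.
rewrite ler_pdivrMr// -(ler_pM2l (_ : 0 < D * delta ^+ 2 / m ^+ 2)); last first.
  by rewrite divr_gt0 ?mulr_gt0 ?exprn_gt0.
rewrite (_ : _ * (W * m ^+ 2) = D * delta ^+ 2 * W); last by field.
by apply: le_trans h2 _; rewrite -/D le_eqVlt; apply/orP; left; apply/eqP; field.
Qed.

End energy.

(** * The sumset *)

Lemma side_small (R : realType) (l e : R) : 0 < l -> 0 < e ->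
  exists n, side l n < e.
Proof.
move=> l0 e0; have el0 : 0 < e / l by rewrite divr_gt0.
have [n _ /(_ _ (leqnn n))] := near_infty_natSinv_lt (PosNum el0).
rewrite ltr_pdivlMr// => /= h; exists n; apply: le_lt_trans h.
rewrite mulrC ler_wpM2l ?(ltW l0)// lef_pV2 ?posrE ?exprn_gt0//.
by rewrite -natrX ler_nat ltn_expl.
Qed.

Lemma frostman_grid (R : realType) (E : set (R * R)) (a l s kappa : R) (n : nat) :
  0 < l -> (forall x, E x -> grid_cell a l 0 x = (0, 0)) ->
  (forall cov : seq (nat * (int * int)),
    (forall x, E x -> exists2 c, c \in cov & grid_cell a l c.1 x = c.2) ->
    kappa <= \sum_(c <- cov) side l c.1 `^ s) ->
  exists w : seq ((R * R) * {nonneg R}),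
    [/\ weights_on E w,
      forall k q, (k <= n)%N ->
        mass w (fun x => grid_cell a l k x == q) <= side l k `^ s &
      kappa <= mass w xpredT].
Proof.
move=> l0 E0 Ekappa.
have [w [cov [[wE wr] covE covw]]] := @frostman R _ _ (grid_cell a l) E
  (fun k => side l k `^ s) (fun k => powR_ge0 _ _)
  (@grid_cell_refine _ a _ l0)
  (fun k q => let: ex_intro cs h := @grid_cell_finite _ a _ l0 k q in
    ex_intro _ cs (fun x _ => h x)) n 0 (0, 0).
exists w; split.
- by apply: weights_onS wE => x [].
- by move=> k q kn; apply: wr.
- apply: le_trans covw; apply: Ekappa => x Ex.
  by have [c cc [_ ?]] := covE x (conj Ex (E0 x Ex)); exists c.
Qed.

Lemma continuous_segment_bounded (R : realType) (c d : R) (f : R -> R) : c <= d ->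
  {within `[c, d], continuous f} ->
  exists2 L, 1 <= L & forall x, x \in `[c, d] -> `|f x| <= L.
Proof.
move=> cd cf; have [u _ fu] := EVT_max cd cf; have [v _ fv] := EVT_min cd cf.
exists (1 + `|f u| + `|f v|); first by rewrite -addrA lerDl addr_ge0.
move=> x xI; have := fu x xI; have := fv x xI.
have := ler_norm (f u); have := ler_norm (- f v); rewrite normrN.
have : 0 <= `|f u| by []. have : 0 <= `|f v| by [].
by move=> *; rewrite ler_norml; apply/andP; split; lra.
Qed.

Unset Implicit Arguments.

Theorem theorem1p3 (R : realType) (Gamma E : set (R * R))
    (Gamma_curve : compact_rectifiable_curve Gamma)
    (Gamma_trace : positive_curved_trace Gamma)
    (E_compact : compact E)
    (E_dim : (1 < hausdorff_dim E)%E) :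
  (0 < planar_lebesgue (minkowski_sum E Gamma))%E.
Proof.
have cGamma : compact Gamma.
  have [a [b [gamma [ab gammac _ ->]]]] := Gamma_curve.
  by apply: continuous_compact gammac _; exact: segment_compact.
have cK := compact_minkowski_sum E_compact cGamma.
have [c [d [g [g' [g'' [A [c0 [[cd [gg' g'g'' _]] [cA AG] A0 c00 c0g'']]]]]]]] :=
  Gamma_trace.
move: gg' g'g'' => /deriv_on_expands gg' /deriv_on_expands g'g''.
have [L L1 g'L] := continuous_segment_bounded (ltW cd) (expands_on_continuous g'g'').
pose T := [set t | t \in `[c, d] /\ A (t, g t)].
have Tcd : T `<=` `[c, d] by move=> t [].
have TA : [set (t, g t) | t in T] = A.
  apply/seteqP; split=> [_ [t [_ At] <-]//|x Ax].
  have [_ [t tI tx]] := AG x Ax; exists t => //; split=> //.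
  by rewrite tx.
have cT : compact [set (t, g t) | t in T] by rewrite TA.
have [tau tau0 Ttau] : exists2 tau : R, 0 < tau &
    forall p, (tau%:E <= lebesgue_measure [set x | T (x - p)%R])%E.
  have [|delta [eta [delta0 eta0 etaA]]] := @hausdorff_measure_gt0 R 1 A.
    by move=> A00; rewrite A00 ltxx in A0.
  apply: (@lipschitz_graph_translates _ T g L delta eta) => //; first by lra.
    by move=> t u /Tcd tI /Tcd uI; apply: expands_on_lipschitz gg' g'L _ _ tI uI.
  by rewrite TA.
have [s s1 /hausdorff_measure_gt0 [delta [eta [delta0 eta0 etaE]]]] :=
  hausdorff_dim_gt ler01 E_dim.
have [a [l [l0 Eroot]]] := compact_in_root_cell E_compact.
have s0 : 0 < s by lra.
have [kappa kappa0 Ekappa] := grid_content_ge a l0 s0 delta0 eta0 etaE.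
have s10 : 0 < s - 1 by lra.
have [M M0 sM] := side_powR_geometric l0 s10.
pose C := 2 * (d - c) + 8 * L / c0.
have C0 : 0 < C.
  by rewrite addr_gt0 ?mulr_gt0 ?invr_gt0//; lra.
have bpos : 0 < kappa * tau ^+ 2 / (25 * C * M).
  by rewrite divr_gt0 ?mulr_gt0 ?exprn_gt0.
suff : ((kappa * tau ^+ 2 / (25 * C * M))%:E <=
    planar_lebesgue (minkowski_sum E Gamma))%E.
  by apply: lt_le_trans; rewrite lte_fin.
apply: (compact_measure_ge cK) => e e0.
have [n ne] := side_small l0 e0.
have [w [wE wr kw]] := frostman_grid n l0 (fun x Ex => (Eroot x Ex).1) Ekappa.
apply: le_trans (union_measure_ge l0 wr (sM n.+1) C0 M0 tau0 wE
  (S := strip T g (side l n)) _ _ _ _ _).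
- by rewrite lee_fin ler_pM2r ?ler_pM2r ?exprn_gt0 ?invr_gt0 ?mulr_gt0.
- by move=> p; exact: strip_measurable.
- move=> p Ep z [Tz /andP[z1 z2]].
  (* The point of [p + A] below [z], at vertical distance at most [side l n]. *)
  exists (p + (z.1 - p.1, g (z.1 - p.1))).
    exists p => //; exists (z.1 - p.1, g (z.1 - p.1)) => //.
    by have [_ /AG[]] := Tz.
  split; rewrite /ball /=.
    by rewrite (_ : _ - _ = 0) ?normr0//; ring.
  by rewrite ltr_norml; apply/andP; split; lra.
- by apply: open_measurable_plane; exact: nbhd_open.
- move=> p; apply: le_trans (strip_measure_ge p cT (ltW (side_gt0 n l0))).
  by rewrite mulrC EFinM lee_wpmul2l// lee_fin ltW// side_gt0.
- move=> p q Ep Eq; apply: (strip_overlap_le n cd gg' g'g'') => //.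
  exact: (Eroot q Eq).2.
Qed.
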